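(* Let $0<\alpha\le 1$ and $m\in(0,1]$. Let $I\subseteq\mathbb{R}$ with $(0,1)\subseteq I$ and let $h:I\to\mathbb{R}^{\alpha}$ be a non-negative integrable function with $h\not\equiv 0$. Let $J\subseteq[0,\infty)$ be an interval with left endpoint $0\in J$, and let $\mathcal{G}:J\to\mathbb{R}^{\alpha}$ be a positive, generalized $(h-m)$-convex and integrable function. Let $\nu,\mu\in J$ with $\nu<\mu$ (and with $\nu/m,\ \mu/m,\ \mu/m^{2}\in J$, so that all expressions below are defined). Then $$\frac{1^{\alpha}}{\Gamma(1+\alpha)}\,\mathcal{G}\left(\frac{\nu+\mu}{2}\right)\le h\left(\frac12\right)\frac{{}_{\nu}\mathcal{I}_{\mu}^{(\alpha)}\left[\mathcal{G}(x)+m^{\alpha}\mathcal{G}\left(\frac{x}{m}\right)\right]}{(\mu-\nu)^{\alpha}}$$ and $$h\left(\frac12\right)\frac{{}_{\nu}\mathcal{I}_{\mu}^{(\alpha)}\left[\mathcal{G}(x)+m^{\alpha}\mathcal{G}\left(\frac{x}{m}\right)\right]}{(\mu-\nu)^{\alpha}}\le h\left(\frac12\right)\frac{1^{\alpha}}{\Gamma(\alpha+1)}\left[\mathcal{G}(\nu)+m^{2\alpha}\mathcal{G}\left(\frac{\mu}{m^{2}}\right)-m^{\alpha}(-1)^{\alpha}\left(\mathcal{G}\left(\frac{\mu}{m}\right)+\mathcal{G}\left(\frac{\nu}{m}\right)\right)\right]{}_{0}\mathcal{I}_{1}^{(\alpha)}h .$$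
   Context: For $0<\alpha\le1$, $\mathbb{R}^{\alpha}$ is Yang's fractal set of $\alpha$-type real numbers $a^{\alpha}$ ($a\in\mathbb{R}$), with $a^{\alpha}+b^{\alpha}=(a+b)^{\alpha}$ and $a^{\alpha}b^{\alpha}=(ab)^{\alpha}$ (both operations commutative and associative, multiplication distributing over addition, neutral elements $0^{\alpha}$ and $1^{\alpha}$), ordered by $a^{\alpha}\le b^{\alpha}$ iff $a\le b$; in particular $(-1)^{\alpha}$ denotes the element of $\mathbb{R}^{\alpha}$ corresponding to $-1$. Local fractional integral: for $\mathcal{G}$ on $[\nu,\mu]$, $${}_{\nu}\mathcal{I}_{\mu}^{(\alpha)}\mathcal{G}(x)=\frac{1}{\Gamma(\alpha+1)}\int_{\nu}^{\mu}\mathcal{G}(\lambda)(d\lambda)^{\alpha}=\frac{1}{\Gamma(\alpha+1)}\lim_{\Delta\lambda\to0}\sum_{j=0}^{N-1}\mathcal{G}(\lambda_j)(\Delta\lambda_j)^{\alpha},$$ where $\nu=\lambda_0<\lambda_1<\dots<\lambda_N=\mu$ is a partition, $\Delta\lambda_j=\lambda_{j+1}-\lambda_j$ and $\Delta\lambda=\max_j\Delta\lambda_j$. ''Integrable'' means that this integral exists. Generalized $(h-m)$-convexity: let $(0,1)\subseteq I\subseteq\mathbb{R}$, let $h:I\to\mathbb{R}^{\alpha}$ be non-negative, and $m\in[0,1]$. A function $\mathcal{G}$ with values in $\mathbb{R}^{\alpha}$, defined on $[0,b]$ (or on an interval in $[0,\infty)$ starting at and containing $0$), is generalized $(h-m)$-convex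 if it is positive (in the sense $\mathcal{G}\ge0^{\alpha}$) and $\mathcal{G}(\gamma\nu+m(1-\gamma)\mu)\le h(\gamma)\mathcal{G}(\nu)+m^{\alpha}h(1-\gamma)\mathcal{G}(\mu)$ for all $\nu,\mu$ in the domain and all $\gamma\in(0,1)$. *)

(* Defs.v *)
From HB Require Import structures.
From mathcomp Require Import all_boot all_order all_algebra.
From mathcomp Require Import all_classical all_reals all_analysis.

Set Implicit Arguments.
Unset Strict Implicit.
Unset Printing Implicit Defensive.

Import Order.TTheory GRing.Theory Num.Theory.
Import numFieldNormedType.Exports.

Local Open Scope classical_set_scope.
Local Open Scope ring_scope.

(* The fractal set R^alpha: the symbols a^alpha (a in R), equipped with the
   structure of R carried over along a |-> a^alpha.  It is a tagged copy of R;
   a^alpha is a formal symbol, not the real power, so that (-1)^alpha makes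
   sense.  A real scalar acts by c *: a^alpha = (c * a)^alpha. *)
Definition fractal (R : realType) (alpha : R) : Type := R.

HB.instance Definition _ (R : realType) (alpha : R) :=
  Num.RealField.copy (fractal alpha) R.
HB.instance Definition _ (R : realType) (alpha : R) :=
  NormedModule.copy (fractal alpha) R^o.

Definition fpow (R : realType) (alpha a : R) : fractal alpha := a.

Section FractalLaws.
Variables (R : realType) (alpha : R).
Implicit Types a b c : R.

Lemma fpow_bij : bijective (fpow alpha).
Proof. by exists (fun x : fractal alpha => (x : R)). Qed.

Lemma fpow0 : fpow alpha 0 = 0. Proof. by []. Qed.

Lemma fpow1 : fpow alpha 1 = 1. Proof. by []. Qed.

Lemma fpowD a b : fpow alpha a + fpow alpha b = fpow alpha (a + b).
Proof. by []. Qed.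

Lemma fpowM a b : fpow alpha a * fpow alpha b = fpow alpha (a * b).
Proof. by []. Qed.

Lemma fpowZ c a : c *: fpow alpha a = fpow alpha (c * a).
Proof. by []. Qed.

Lemma fpowV a : (fpow alpha a)^-1 = fpow alpha a^-1.
Proof. by []. Qed.

Lemma ler_fpow a b : (fpow alpha a <= fpow alpha b) = (a <= b).
Proof. by []. Qed.

Lemma normr_fpow a : `|fpow alpha a| = `|a| :> R.
Proof. by []. Qed.

End FractalLaws.

Definition Gamma (R : realType) (x : R) : R :=
  (\int[lebesgue_measure]_(t in `]0%R, +oo[) (t `^ (x - 1) * expR (- t)))%R.

(* In the definitions below a partition nu = l_0 < l_1 < ... < l_N = mu is
   encoded, as in itv_partition, by the sequence s = [:: l_1; ...; l_N]. *)
Definition mesh (R : realType) (nu : R) (s : seq R) : R :=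
  \big[Num.max/0]_(j < size s) (nth 0 (nu :: s) j.+1 - nth 0 (nu :: s) j).

Definition mesh_to_0 (R : realType) (nu mu : R) : set_system (seq R) :=
  filter_from [set d : R | 0 < d]
    (fun d => [set s | itv_partition nu mu s /\ mesh nu s < d]).

Definition lf_sum (R : realType) (alpha : R) (G : R -> fractal alpha)
    (nu : R) (s : seq R) : fractal alpha :=
  \sum_(j < size s) G (nth 0 (nu :: s) j) *
                    fpow alpha (nth 0 (nu :: s) j.+1 - nth 0 (nu :: s) j).

(* Only meaningful for nu < mu.  The value G nu does not influence the limit,
   being multiplied by the length of the first step; hence the integral from 0
   to 1 makes sense for a function specified on `]0, 1[ only. *)
Definition lf_integrable (R : realType) (alpha : R) (nu mu : R)
    (G : R -> fractal alpha) : Prop :=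
  cvg (lf_sum G nu s @[s --> mesh_to_0 nu mu]).

Definition lf_integral (R : realType) (alpha : R) (nu mu : R)
    (G : R -> fractal alpha) : fractal alpha :=
  (Gamma (alpha + 1))^-1 *: lim (lf_sum G nu s @[s --> mesh_to_0 nu mu]).

Definition hm_convex (R : realType) (alpha : R) (J : set R)
    (h : R -> fractal alpha) (m : R) (G : R -> fractal alpha) : Prop :=
  (forall x, J x -> 0 <= G x) /\
  (forall x y g, J x -> J y -> 0 < g < 1 ->
     G (g * x + m * (1 - g) * y) <=
       h g * G x + fpow alpha m * h (1 - g) * G y).

(* Main.v *)
Require Import Defs.
From HB Require Import structures.
From mathcomp Require Import all_boot all_order all_algebra.
From mathcomp Require Import all_classical all_reals all_analysis.
From mathcomp Require Import measurable_realfun ring lra.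
Import Order.TTheory GRing.Theory Num.Theory.
Import numFieldNormedType.Exports.
Local Open Scope classical_set_scope.
Local Open Scope ring_scope.

(** Write [k] for the inverse of [Gamma (alpha + 1)].  After identifying the
    fractal set with the real line, the local fractional integral is [k] times
    a limit of left Riemann sums, so both inequalities follow from pointwise
    ones that are averaged and then passed to the limit.

    Put [x t = nu + (mu - nu) t] for [0 < t < 1].  Convexity with weight 1/2 at
    the points [x t] and [x (1 - t) / m] has the fixed midpoint
    [(nu + mu) / 2] and gives [hm_convex_midpoint]:
      [G ((nu + mu) / 2) <= h (1/2) (G (x t) + m G (x (1 - t) / m))].
    Convexity with weight [1 - t] along the chord from [nu] to [mu] and along
    the chord from [nu / m] to [mu / m] gives, by [hm_convex_chord],
      [G (x t) + m G (x t / m) <= A h (1 - t) + B h t],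
    where [A = G nu + m G (nu / m)] and
    [B = m G (mu / m) + m^2 G (mu / m^2)].

    Integrating these needs the substitution [t -> 1 - t], but left Riemann
    sums are not symmetric: a function such as [h] may be unbounded near 1 and
    integrable, while its reflection is then not integrable.  The remedy is to
    take limits only along uniform partitions, and to drop the left endpoint,
    whose contribution tends to 0.  What is left is the mean of the
    function over the interior nodes [j / (n + 1)], [interior_mean], which
    converges to the integral ([interior_mean_cvg]) and is exactly invariant
    under [t -> 1 - t] ([interior_mean_rev]).

    The upper bound of the theorem contains [k] twice, once explicitly and once
    in the integral of [h], whereas averaging produces it only once.  The
    inequality [k <= k * k] closes the gap: [Gamma (alpha + 1) <= 1] for
    [0 <= alpha <= 1] ([Gamma_le1]), because [t `^ alpha] lies below its
    tangent at 1 and the tangent has integral 1 against [expR (- t)]. *)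

(** * The Gamma function on the interval from 1 to 2 *)

Section GammaBound.
Context {R : realType}.
Implicit Types (alpha t : R).

(** Concavity of the logarithm between [t] and 1, exponentiated. *)
Lemma powR_le_tangent alpha t : 0 <= alpha <= 1 -> 0 < t ->
  t `^ alpha <= 1 + alpha * (t - 1).
Proof.
move=> /andP[a0 a1] t0.
have := @concave_ln R (Itv01 a0 a1) t 1 t0 ltr01.
rewrite ln1 !convRE /= mulr0 addr0 mulr1 => le_ln.
have p0 : 0 < 1 + alpha * (t - 1) by nra.
rewrite /powR gt_eqF// -[leRHS]lnK ?posrE// ler_expR (le_trans le_ln)//.
rewrite ler_ln ?posrE /unstable.onem //; lra.
Qed.

(** [- (1 + alpha t) expR (- t)] is a primitive that vanishes at infinity; at 0
    it is [-1]. *)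
Lemma integral_affine_expRN alpha : 0 <= alpha <= 1 ->
  (\int[lebesgue_measure]_(t in `]0%R, +oo[)
     ((1 + alpha * (t - 1)) * expR (- t))%:E = 1)%E.
Proof.
move=> /andP[a0 a1].
pose f t := (1 + alpha * (t - 1)) * expR (- t).
pose F t : R := - ((1 + alpha * t) * expR (- t)).
have dF t : is_derive t 1 F (f t).
  rewrite /F; apply: is_derive_eq.
  by rewrite /f /GRing.scale /=; ring.
have df t : derivable f t 1.
  by rewrite /f; apply: ex_derive.
have cf : continuous f.
  by move=> t; apply/differentiable_continuous/derivable1_diffP.
have cF : continuous F.
  by move=> t; apply/differentiable_continuous/derivable1_diffP; apply: ex_derive.
rewrite integral_itv_obnd_cbnd; last first.
  apply/measurable_EFinP/measurable_funTS.
  exact: (continuous_measurable_fun cf).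
rewrite (@ge0_continuous_FTC2y _ f F _ 0).
- by rewrite /F mulr0 addr0 oppr0 expR0 mulr1 EFinN oppeK add0e.
- by move=> t t0; rewrite mulr_ge0 ?expR_ge0//; nra.
- exact: continuous_subspaceT.
- rewrite -oppr0; apply: cvgN.
  apply: (@squeeze_cvgr _ _ _ _ (fun=> 0) (fun t => 2 * expR (- (2^-1 * t)))).
  + near=> t.
    have t0 : 0 <= t by near: t; exact: nbhs_pinfty_ge.
    (* Half of the exponential decay absorbs the affine factor. *)
    have half : 1 + 2^-1 * t <= expR (2^-1 * t) by exact: expR_ge1Dx.
    have -> : expR (- t) = expR (- (2^-1 * t)) * expR (- (2^-1 * t)).
      by rewrite -expRD; congr expR; lra.
    have := expR_gt0 (- (2^-1 * t)); set w := expR _ => w0.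
    have wE : w * expR (2^-1 * t) = 1 by rewrite /w expRN mulVf// expR_eq0.
    apply/andP; split; first by rewrite mulr_ge0 ?mulr_ge0 ?ltW//; nra.
    have -> : 2 * w = 2 * expR (2^-1 * t) * (w * w).
      by transitivity (2 * (w * expR (2^-1 * t)) * w); [rewrite wE mulr1|ring].
    by rewrite ler_wpM2r ?mulr_ge0 ?ltW//; nra.
  + exact: cvg_cst.
  + rewrite -(mulr0 2); apply: cvgMl_tmp.
    apply: (@cvg_comp _ _ _ (fun t => 2^-1 * t) (fun z => expR (- z)) _
      (pinfty_nbhs R)); last exact: cvgr_expR.
    by apply: gt0_cvgMry => //; rewrite invr_gt0.
- by move=> t _; exact: ex_derive.
- exact/cvg_at_right_filter/cF.
- by move=> t _; rewrite derive1E derive_val.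
Unshelve. all: by end_near. Qed.

Lemma Gamma_ge0 (x : R) : 0 <= Gamma x.
Proof.
by apply: Rintegral_ge0 => t _; rewrite mulr_ge0 ?powR_ge0 ?expR_ge0.
Qed.

Lemma Gamma_le1 alpha : 0 <= alpha <= 1 -> Gamma (alpha + 1) <= 1.
Proof.
move=> a01; rewrite /Gamma addrK /Rintegral.
set I := (X in fine X).
(* [fine] sends an infinite value to 0, which is also at most 1. *)
suff : (I <= 1)%E by case: I => //= [r|]; rewrite ?lee_fin ?ler01.
have cN : continuous (fun t : R => expR (- t)).
  move=> t.
  by apply: continuous_comp; [exact: continuousN|exact: continuous_expR].
rewrite -(integral_affine_expRN _ a01); apply: ge0_le_integral => //.
- by move=> t _; rewrite lee_fin mulr_ge0 ?powR_ge0 ?expR_ge0.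
- apply/measurable_EFinP/measurable_funTS/measurable_funM.
    exact: measurable_realfun.measurable_powR.
  exact: continuous_measurable_fun.
- apply/measurable_EFinP/measurable_funTS/measurable_funM.
    by do !apply: measurable_funD => //; apply: measurable_funM => //;
      apply: measurable_funD.
  exact: continuous_measurable_fun.
- move=> t; rewrite /= in_itv/= andbT => t0.
  by rewrite lee_fin ler_wpM2r ?expR_ge0 ?powR_le_tangent.
Qed.

End GammaBound.

(** * Partitions and left Riemann sums *)

Section FractalIntegral.
Context {R : realType} {alpha : R}.
Implicit Types (a b c d m : R) (f g : R -> fractal alpha) (s : seq R).

Lemma mesh_ltP d a s : 0 < d ->
  mesh a s < d <->
  forall j, (j < size s)%N -> nth 0 (a :: s) j.+1 - nth 0 (a :: s) j < d.
Proof.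
move=> d0; split=> [/bigmax_ltP[_ lt_d] j js|lt_d].
  exact: lt_d (Ordinal js) isT.
by apply/bigmax_ltP; split=> // i _; apply: lt_d.
Qed.

#[local] Instance mesh_to_0_filter a b : Filter (mesh_to_0 a b).
Proof.
apply: filter_from_filter; first by exists 1 => /=.
move=> d e d0 e0; exists (Num.min d e); first by rewrite /= lt_min; apply/andP.
by move=> s [ps]; rewrite lt_min => /andP[].
Qed.

Definition uniform_partition a b n : seq R :=
  mkseq (fun j => a + (b - a) * (j.+1%:R / n.+1%:R)) n.+1.

Lemma nth_uniform_partition a b n j : (j <= n.+1)%N ->
  nth 0 (a :: uniform_partition a b n) j = a + (b - a) * (j%:R / n.+1%:R).
Proof.
case: j => [_|j jn]; first by rewrite mul0r mulr0 addr0.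
by rewrite -[LHS]/(nth 0 (uniform_partition a b n) j) nth_mkseq.
Qed.

Lemma uniform_partition_step a b n j : (j < n.+1)%N ->
  nth 0 (a :: uniform_partition a b n) j.+1
  - nth 0 (a :: uniform_partition a b n) j = (b - a) / n.+1%:R.
Proof.
by move=> jn; rewrite !nth_uniform_partition// 1?ltnW// -natr1; ring.
Qed.

Lemma uniform_partition_itv a b n : a < b ->
  itv_partition a b (uniform_partition a b n).
Proof.
move=> ab; split.
  apply/(pathP 0) => j; rewrite size_mkseq => jn.
  rewrite -subr_gt0 -[X in X - _]/(nth 0 (a :: uniform_partition a b n) j.+1).
  by rewrite uniform_partition_step// divr_gt0// subr_gt0.
rewrite (last_nth 0) size_mkseq nth_uniform_partition// divff ?pnatr_eq0//.
by rewrite mulr1 addrC subrK.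
Qed.

(** Hence a limit over all partitions can be computed along uniform ones. *)
Lemma cvg_uniform_partition a b : a < b ->
  uniform_partition a b n @[n --> \oo] --> mesh_to_0 a b.
Proof.
move=> ab; apply/filter_fromP => d /= d0.
have : (b - a) * harmonic n @[n --> \oo] --> (b - a) * 0.
  exact: cvgMl_tmp cvg_harmonic.
rewrite mulr0 => /cvgr_lt/(_ _ d0); apply: filterS => n step_lt; split.
  exact: uniform_partition_itv.
apply/mesh_ltP => // j; rewrite size_mkseq => jn.
by rewrite uniform_partition_step.
Qed.

Lemma lf_sumD a f g s :
  lf_sum (fun x => f x + g x) a s = lf_sum f a s + lf_sum g a s.
Proof.
by rewrite /lf_sum -big_split; apply: eq_bigr => j _; rewrite mulrDl.
Qed.

Lemma lf_sumZ a (c : fractal alpha) f s :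
  lf_sum (fun x => c * f x) a s = c * lf_sum f a s.
Proof.
by rewrite /lf_sum mulr_sumr; apply: eq_bigr => j _; rewrite mulrA.
Qed.

Lemma lf_integrableD a b f g : lf_integrable a b f -> lf_integrable a b g ->
  lf_integrable a b (fun x => f x + g x).
Proof.
move=> If Ig; rewrite /lf_integrable.
under eq_fun do rewrite lf_sumD.
exact: is_cvgD.
Qed.

Lemma lf_integrableZ a b (c : fractal alpha) f :
  lf_integrable a b f -> lf_integrable a b (fun x => c * f x).
Proof.
move=> If; rewrite /lf_integrable.
under eq_fun do rewrite lf_sumZ.
exact: (@is_cvgMl_tmp R).
Qed.

Lemma nth_map_divr m a s j : nth 0 (a / m :: map (fun x => x / m) s) j =
  nth 0 (a :: s) j / m.
Proof.
rewrite -[LHS]/(nth 0 (map (fun x => x / m) (a :: s)) j).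
have [js|js] := ltnP j (size (a :: s)).
  by rewrite (nth_map 0).
by rewrite !nth_default ?size_map// mul0r.
Qed.

Lemma lf_sum_divr m a f s : m != 0 ->
  lf_sum (fun x => f (x / m)) a s
  = fpow alpha m * lf_sum f (a / m) (map (fun x => x / m) s).
Proof.
move=> m0; rewrite /lf_sum mulr_sumr size_map; apply: eq_bigr => j _.
rewrite !nth_map_divr mulrCA; congr (_ * _).
by rewrite /fpow -mulrBl mulrCA divff// mulr1.
Qed.

(** Dilation by [1 / m] turns fine partitions of the first interval into fine
    partitions of the second; with [lf_sum_divr] it gives the change of
    variables [x / m] for integrability. *)
Lemma cvg_map_divr m a b : 0 < m ->
  map (fun x => x / m) s @[s --> mesh_to_0 a b] --> mesh_to_0 (a / m) (b / m).
Proof.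
move=> m0; apply/filter_fromP => d /= d0.
exists (d * m); first by rewrite /= mulr_gt0.
move=> s [[ps /eqP ls] /mesh_ltP]; rewrite mulr_gt0// => /(_ isT) lt_dm; split.
  split; last by rewrite -ls (last_map (fun x => x / m)).
  apply: (homo_path (f := fun x => x / m)) ps => x y xy.
  by rewrite ltr_pM2r// invr_gt0.
apply/mesh_ltP => // j; rewrite size_map => js.
by rewrite !nth_map_divr -mulrBl ltr_pdivrMr// lt_dm.
Qed.

Lemma lf_integrable_divr m a b f : 0 < m ->
  lf_integrable (a / m) (b / m) f -> lf_integrable a b (fun x => f (x / m)).
Proof.
move=> m0 If; rewrite /lf_integrable.
under eq_fun do rewrite lf_sum_divr ?gt_eqF//.
apply: (@is_cvgMl_tmp R).
apply/cvg_ex.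
exists (lim (lf_sum f (a / m) s @[s --> mesh_to_0 (a / m) (b / m)])).
exact: cvg_comp (cvg_map_divr _ _ _ m0) If.
Qed.

End FractalIntegral.

(** * Means over interior nodes *)

Section InteriorMean.
Context {R : realType}.
Implicit Types (u v : R -> R) (c : R).

(** The sum is divided by the number of subintervals, one more than the number
    of nodes: this is the Riemann sum of [u] for the uniform partition of the
    unit interval without its term at 0. *)
Definition interior_mean u n : R :=
  n.+1%:R^-1 * \sum_(1 <= j < n.+1) u (j%:R / n.+1%:R).

Lemma le_interior_mean u v n : (forall t, 0 < t < 1 -> u t <= v t) ->
  interior_mean u n <= interior_mean v n.
Proof.
move=> uv; rewrite ler_wpM2l ?invr_ge0//.
apply: ler_sum_nat => j /andP[j0 jn]; apply: uv.
by rewrite divr_gt0 ?ltr0n//= ltr_pdivrMr ?ltr0n// mul1r ltr_nat.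
Qed.

Lemma interior_meanD u v n :
  interior_mean (fun t => u t + v t) n = interior_mean u n + interior_mean v n.
Proof. by rewrite /interior_mean big_split mulrDr. Qed.

Lemma interior_meanZ c u n :
  interior_mean (fun t => c * u t) n = c * interior_mean u n.
Proof. by rewrite /interior_mean -mulr_sumr mulrCA. Qed.

Lemma interior_mean_cst c n : interior_mean (fun=> c) n = c * (1 - harmonic n).
Proof.
rewrite /interior_mean big_const_nat iter_addr_0 subn1 -[c *+ _]mulr_natr.
rewrite /harmonic mulrCA; congr (c * _).
rewrite -[LHS](addrK n.+1%:R^-1); congr (_ - _).
by rewrite -[X in _ + X]mulr1 -mulrDr natr1 mulVf// pnatr_eq0.
Qed.

(** The set of interior nodes is symmetric about 1/2.  With the node 0 kept, this
    would only hold up to a boundary term, and [u 1] would enter. *)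
Lemma interior_mean_rev u n :
  interior_mean (fun t => u (1 - t)) n = interior_mean u n.
Proof.
rewrite /interior_mean big_nat_rev/=; congr (_ * _).
apply: eq_big_nat => j /andP[j0 jn]; congr u.
rewrite add1n subSS natrB; last exact: ltnW.
by field; rewrite nat1r pnatr_eq0.
Qed.

(** The omitted term at the left endpoint is [f a] times the step, which tends
    to 0 whatever the value [f a]. *)
Lemma interior_mean_cvg (alpha a b : R) (f : R -> fractal alpha) : a < b ->
  lf_integrable a b f ->
  (Gamma (alpha + 1))^-1 * interior_mean (fun t => f (a + (b - a) * t)) n
    @[n --> \oo]
  --> (lf_integral a b f / fpow alpha (b - a) : R).
Proof.
move=> ab If; have ba0 : b - a != 0 by rewrite subr_eq0 gt_eqF.
pose u t : R := f (a + (b - a) * t).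
set L : R := lim (lf_sum f a s @[s --> mesh_to_0 a b]).
have sumE n : lf_sum f a (uniform_partition a b n)
    = (b - a) * (interior_mean u n + harmonic n * u 0) :> R.
  rewrite /lf_sum size_mkseq.
  under eq_bigr do
    rewrite uniform_partition_step// nth_uniform_partition 1?ltnW//.
  rewrite -mulr_suml.
  rewrite -(big_mkord xpredT (fun j => f (a + (b - a) * (j%:R / n.+1%:R)))).
  rewrite big_ltn// mul0r [LHS]mulrC /interior_mean /harmonic /u /fpow.
  by rewrite -mulrDr [RHS]mulrA; congr (_ * _); exact: addrC.
have cvg_sum : lf_sum f a (uniform_partition a b n) @[n --> \oo] --> L.
  exact: cvg_comp (cvg_uniform_partition _ _ ab) If.
have -> : lf_integral a b f / fpow alpha (b - a)
   = (Gamma (alpha + 1))^-1 * (L / (b - a) - 0 * u 0) :> R.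
  by rewrite mul0r subr0 mulrA.
apply: cvgMl_tmp.
have -> : interior_mean u = (fun n =>
    (lf_sum f a (uniform_partition a b n) : R) / (b - a) - harmonic n * u 0).
  apply/funext => n; rewrite sumE; field.
  by rewrite ba0.
apply: cvgB; last exact: (@cvgMr_tmp R _ _ _ _ _ _ cvg_harmonic).
exact: (@cvgMr_tmp R _ _ _ _ _ _ cvg_sum).
Qed.

End InteriorMean.

(** * Pointwise consequences of convexity *)

Section PointwiseBounds.
Context {R : realType} {alpha m : R} {J : set R} {h G : R -> R}.
Hypotheses (m0 : m != 0) (G_conv : @hm_convex R alpha J h m G).

(** Dividing the second point by [m] makes the left-hand side depend on [x + y]
    only, hence constant along reflected pairs of points. *)
Lemma hm_convex_midpoint x y : J x -> J (y / m) ->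
  G ((x + y) / 2) <= h (1 / 2) * (G x + m * G (y / m)).
Proof.
move=> Jx Jy; have half01 : 0 < (1 / 2 : R) < 1 by lra.
have := G_conv.2 _ _ _ Jx Jy half01.
have -> : 1 / 2 * x + m * (1 - 1 / 2) * (y / m) = (x + y) / 2 by field.
have -> : 1 - 1 / 2 = 1 / 2 :> R by field.
by move=> le; rewrite mulrDr mulrA [h _ * m]mulrC.
Qed.

Lemma hm_convex_chord x y t : J x -> J (y / m) -> 0 < t < 1 ->
  G (x + (y - x) * t) <= h (1 - t) * G x + h t * (m * G (y / m)).
Proof.
move=> Jx Jy t01; have t01' : 0 < 1 - t < 1 by lra.
have := G_conv.2 _ _ _ Jx Jy t01'.
have -> : (1 - t) * x + m * (1 - (1 - t)) * (y / m) = x + (y - x) * t by field.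
by rewrite subKr => le; rewrite mulrA [h t * m]mulrC.
Qed.

End PointwiseBounds.

(** * The two inequalities *)

Theorem theorem7 (R : realType) (alpha m : R)
  (halpha : 0 < alpha <= 1) (hm : 0 < m <= 1)
  (I : set R) (hI : `]0, 1[ `<=` I)
  (h : R -> fractal alpha)
  (h_ge0 : forall x, I x -> 0 <= h x)
  (h_int : lf_integrable 0 1 h)
  (h_neq0 : exists2 x, I x & h x <> 0)
  (J : set R) (J_itv : is_interval J) (J_ge0 : J `<=` `[0, +oo[) (J0 : J 0)
  (G : R -> fractal alpha)
  (G_ge0 : forall x, J x -> 0 <= G x)
  (G_conv : hm_convex J h m G)
  (G_int : forall a b, J a -> J b -> a < b -> lf_integrable a b G)
  (nu mu : R) (Jnu : J nu) (Jmu : J mu) (nu_lt_mu : nu < mu)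
  (Jnum : J (nu / m)) (Jmum : J (mu / m)) (Jmumm : J (mu / m ^+ 2)) :
  ((Gamma (1 + alpha))^-1 *: fpow alpha 1) * G ((nu + mu) / 2)
    <= h (1 / 2) *
       (lf_integral nu mu (fun x => G x + fpow alpha m * G (x / m))
        / fpow alpha (mu - nu))
  /\
  h (1 / 2) *
    (lf_integral nu mu (fun x => G x + fpow alpha m * G (x / m))
     / fpow alpha (mu - nu))
    <= h (1 / 2) * ((Gamma (alpha + 1))^-1 *: fpow alpha 1) *
       (G nu + fpow alpha (m ^+ 2) * G (mu / m ^+ 2)
        - fpow alpha m * fpow alpha (-1) * (G (mu / m) + G (nu / m))) *
       lf_integral 0 1 h.
Proof.
have /andP[m0 _] := hm; have mN0 : m != 0 by rewrite gt_eqF.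
have Iin (t : R) : 0 < t < 1 -> I t.
  by move=> t01; apply: hI; rewrite /= in_itv.
have h_half : 0 <= h (1 / 2) by apply/h_ge0/Iin; lra.
have minv_lt : nu / m < mu / m by rewrite ltr_pM2r ?invr_gt0.
pose x (t : R) := nu + (mu - nu) * t.
have x_itv t : 0 < t < 1 -> nu <= x t <= mu by rewrite /x => t01; nra.
have Jx t : 0 < t < 1 -> J (x t).
  by move=> /x_itv; exact: J_itv.
have Jxm t : 0 < t < 1 -> J (x t / m).
  move=> /x_itv xt; apply: (J_itv _ _ Jnum Jmum).
  by rewrite !ler_pM2r ?invr_gt0.
pose H (y : R) : fractal alpha := G y + fpow alpha m * G (y / m).
have IH : lf_integrable nu mu H.
  apply: lf_integrableD; first exact: G_int.
  by apply/lf_integrableZ/lf_integrable_divr => //; exact: G_int.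
pose k := (Gamma (alpha + 1))^-1.
have k0 : 0 <= k by rewrite invr_ge0 Gamma_ge0.
(* Either Gamma vanishes and [k] is 0, since 0 is its own inverse here, or
   [1 <= k]. *)
have k_le : k <= k * k.
  have [G0|Gpos] := eqVneq (Gamma (alpha + 1)) 0.
    by rewrite /k G0 invr0 mulr0.
  rewrite ler_peMr// invf_ge1 ?lt0r ?Gpos ?Gamma_ge0// Gamma_le1//.
  by case/andP: halpha => /ltW -> ->.
have meanH n : interior_mean (fun t => H (x t)) n =
    interior_mean (fun t => G (x t)) n
    + m * interior_mean (fun t => G (x t / m)) n.
  by rewrite -[m * _]interior_meanZ -interior_meanD.
pose X : R := lf_integral nu mu H / fpow alpha (mu - nu).
pose Y : R := lf_integral 0 1 h.
have cvgH : k * interior_mean (fun t => H (x t)) n @[n --> \oo] --> X.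
  exact: interior_mean_cvg _ _ _ _ nu_lt_mu IH.
have cvgh : k * interior_mean h n @[n --> \oo] --> Y.
  have := interior_mean_cvg _ _ _ _ ltr01 h_int.
  have -> : (fun t => h (0 + (1 - 0) * t)) = h.
    by apply/funext => t; rewrite add0r subr0 mul1r.
  have -> // : lf_integral 0 1 h / fpow alpha (1 - 0) = Y.
  by rewrite subr0 fpow1 divr1.
pose c : R := h (1 / 2); pose M : R := G ((nu + mu) / 2).
split.
  have midpoint t : 0 < t < 1 -> M <= c * (G (x t) + m * G (x (1 - t) / m)).
    move=> t01; have t01' : 0 < 1 - t < 1 by lra.
    have := hm_convex_midpoint mN0 G_conv _ _ (Jx _ t01) (Jxm _ t01').
    by have -> : x t + x (1 - t) = nu + mu by rewrite /x; ring.
  have mean_midpoint n : k * (M * (1 - harmonic n)) <=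
      c * (k * interior_mean (fun t => H (x t)) n).
    rewrite [leRHS]mulrCA ler_wpM2l// -interior_mean_cst.
    rewrite meanH -(interior_mean_rev (fun t => G (x t / m))).
    rewrite -interior_meanZ -interior_meanD -interior_meanZ.
    exact: le_interior_mean midpoint.
  have cvgM : k * (M * (1 - harmonic n)) @[n --> \oo] --> k * (M * (1 - 0)).
    do 2!apply: cvgMl_tmp; apply: cvgB; [exact: cvg_cst|exact: cvg_harmonic].
  have cvgcH : c * (k * interior_mean (fun t => H (x t)) n) @[n --> \oo]
      --> c * X.
    exact: cvgMl_tmp.
  have lim_le : k * (M * (1 - 0)) <= c * X.
    exact: ler_cvg_to cvgM cvgcH (nearW _ mean_midpoint).
  rewrite [1 + alpha]addrC -[leLHS]/(k * 1 * M : R).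
  by rewrite mulr1; rewrite subr0 mulr1 in lim_le.
pose A : R := G nu + m * G (nu / m).
pose B : R := m * G (mu / m) + m ^+ 2 * G (mu / m ^+ 2).
have A0 : 0 <= A.
  by rewrite addr_ge0 ?mulr_ge0 ?(ltW m0)//; exact: G_ge0.
have B0 : 0 <= B.
  by rewrite addr_ge0 ?mulr_ge0 ?exprn_ge0 ?(ltW m0)//; exact: G_ge0.
have chord t : 0 < t < 1 -> (H (x t) : R) <= A * h (1 - t) + B * h t.
  move=> t01; have := hm_convex_chord mN0 G_conv _ _ t Jnu Jmum t01.
  have mumE : mu / m / m = mu / m ^+ 2 by field.
  have := hm_convex_chord mN0 G_conv (nu / m) (mu / m) t Jnum.
  rewrite mumE => /(_ Jmumm t01).
  have -> : nu / m + (mu / m - nu / m) * t = x t / m by rewrite /x; field.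
  rewrite -(ler_pM2l m0) => le1 le2.
  have := lerD le2 le1; rewrite -[X in X <= _]/(H (x t) : R) => /le_trans; apply.
  rewrite le_eqVlt; apply/orP; left; apply/eqP; rewrite /A /B; ring.
have mean_chord n : k * interior_mean (fun t => H (x t)) n
    <= k * ((A + B) * (k * interior_mean h n)).
  have mean_h0 : 0 <= interior_mean h n.
    have := @le_interior_mean R (fun=> 0) h n (fun t t01 => h_ge0 _ (Iin _ t01)).
    by rewrite interior_mean_cst mul0r.
  have mean_le : interior_mean (fun t => H (x t)) n
      <= (A + B) * interior_mean h n.
    apply: (le_trans (le_interior_mean _ _ n chord)).
    rewrite interior_meanD !interior_meanZ (interior_mean_rev h).
    by rewrite -mulrDl.
  apply: (le_trans (ler_wpM2l k0 mean_le)).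
  rewrite [leRHS](_ : _ = (k * k) * ((A + B) * interior_mean h n)); last by ring.
  by rewrite ler_wpM2r// mulr_ge0// addr_ge0.
have cvgkh : k * ((A + B) * (k * interior_mean h n)) @[n --> \oo]
    --> k * ((A + B) * Y).
  by do 2!apply: cvgMl_tmp.
have lim_le : X <= k * ((A + B) * Y).
  exact: ler_cvg_to cvgH cvgkh (nearW _ mean_chord).
(* The tagged copy of the reals is unfolded before normalising with [ring]. *)
rewrite -[leLHS]/(c * X : R) -[leRHS]/(c * (k * 1) *
  (G nu + m ^+ 2 * G (mu / m ^+ 2)
   - m * - 1 * (G (mu / m) + G (nu / m))) * Y : R).
rewrite [leRHS](_ : _ = c * (k * ((A + B) * Y))); last by rewrite /A /B; ring.
exact: ler_wpM2l.
Qed.
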